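(* Let $G$ be a finite acyclic directed graph. If the independence poset $\mathrm{top}(G)$ is a lattice, then it is a trim lattice.
   Context: All directed graphs are finite, acyclic (no directed cycles, hence no loops) and without multiple edges; $g\in G$ means $g$ is a vertex of $G$, and $g\to h$ denotes an edge from $g$ to $h$. The $G$-order is the partial order on vertices with $g_1\ge g_2$ iff there is a directed path (possibly of length $0$) from $g_1$ to $g_2$. An independent set is a set of pairwise non-adjacent vertices. A pair $(\mathcal D,\mathcal U)$ of disjoint independent sets is orthogonal if there is no edge from an element of $\mathcal D$ to an element of $\mathcal U$. An orthogonal pair of independent sets is tight if none of the following operations results in an orthogonal pair of independent sets: removing some $d\in\mathcal D$ and inserting in $\mathcal D$ an element $d'\notin\mathcal D$ with $d'>d$; removing some $u\in\mathcal U$ and inserting in $\mathcal U$ an element $u'\notin\mathcal U$ with $u'<u$; adding a new element to $\mathcal D$; adding a new element to $\mathcal U$. A tight orthogonal pair is called a top, and $\mathrm{top}(G)$ is the set of tops of $G$. A linear extension $\ell$ of $G$-order is a total order on the vertices such that if $g_1\to g_2$ is an edge then $g_2$ precedes $g_1$; a reverse linear extension $\ell'$ is a total order in which $g_1$ precedes $g_2$ whenever $g_1\to g_2$. Flips: for $(\mathcal D,\mathcal U)\in\mathrm{top}(G)$ and $g\in G$, define $\mathrm{flip}_g(\mathcal D,\mathcal U)=(\mathcal D,\mathcal U)$ if $g\notin\mathcal D\cup\mathcal U$. Otherwise start with $\mathcal D'=\{k\in\mathcal D: k\not\le g\}$ and $\mathcal U'=\{k\in\mathcal U:k\not\ge g\}$;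 add $g$ to $\mathcal D'$ if $g\in\mathcal U$, and add $g$ to $\mathcal U'$ if $g\in\mathcal D$. Then, for $k\not\ge g$ in the order of a reverse linear extension $\ell'$, add $k$ to $\mathcal D'$ if $k\notin\mathcal U'$, there is no edge from $k$ to $\mathcal U'$, and there is no edge from the current $\mathcal D'$ to $k$. Then, for $k\not\le g$ in the order of a linear extension $\ell$, add $k$ to $\mathcal U'$ if $k\notin\mathcal D'$, there is no edge from $\mathcal D'$ to $k$, and there is no edge from $k$ to the current $\mathcal U'$. The result $(\mathcal D',\mathcal U')$ is $\mathrm{flip}_g(\mathcal D,\mathcal U)$; it is a top and does not depend on the choice of $\ell,\ell'$. The independence poset, also denoted $\mathrm{top}(G)$, is the set $\mathrm{top}(G)$ with the reflexive and transitive closure of the relations $(\mathcal D,\mathcal U)<\mathrm{flip}_g(\mathcal D,\mathcal U)$ for $g\in\mathcal U$ (this is a partial order). A chain $x_0<x_1<\cdots<x_r$ has length $r$. A finite lattice is extremal if the length of its longest chain equals both its number of join-irreducible elements and its number of meet-irreducible elements. An element $x$ of a lattice is left modular if $(y\vee x)\wedge z=y\vee(x\wedge z)$ for all $y\le z$; a lattice is left modular if it has a maximal chain of left modular elements. A trim lattice is an extremal left modular lattice. *)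

(* Defs.v *)
From mathcomp Require Import all_boot all_order.
Set Implicit Arguments.
Unset Strict Implicit.
Unset Printing Implicit Defensive.
Import Order.LTheory.

(* A directed graph without multiple edges is a relation [e] on a finite type;
   the edge [g -> h] is [e g h]. *)
Section Tops.
Variables (T : finType) (e : rel T).

(* There is no nonempty closed directed walk. *)
Definition acyclic := forall c : seq T, cycle e c -> c = [::].

Definition geG (g h : T) : bool := connect e g h.
Definition gtG (g h : T) : bool := (g != h) && geG g h.

Definition independent (A : {set T}) : bool :=
  [forall x in A, forall y in A, ~~ e x y].

(* A pair [P] stands for (D, U) with [D = P.1] and [U = P.2]. *)
Definition orthogonal (P : {set T} * {set T}) : bool :=
  [&& [disjoint P.1 & P.2], independent P.1, independent P.2
    & [forall d in P.1, forall u in P.2, ~~ e d u]].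

Definition tight (P : {set T} * {set T}) : bool :=
  let: (D, U) := P in
  [&& [forall d in D, forall d', (d' \notin D) && gtG d' d
          ==> ~~ orthogonal (d' |: (D :\ d), U)],
      [forall u in U, forall u', (u' \notin U) && gtG u u'
          ==> ~~ orthogonal (D, u' |: (U :\ u))],
      [forall d', (d' \notin D) ==> ~~ orthogonal (d' |: D, U)]
    & [forall u', (u' \notin U) ==> ~~ orthogonal (D, u' |: U)]].

Definition is_top (P : {set T} * {set T}) : bool := orthogonal P && tight P.

Definition top := {P : {set T} * {set T} | is_top P}.

(* A total order on [T] is encoded by its enumeration in increasing order,
   so that "x precedes y" is [index x l < index y l]. *)
Definition total_order_seq (l : seq T) : bool :=
  uniq l && [forall x, x \in l].

Definition linear_extension (l : seq T) : bool :=
  total_order_seq l &&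
  [forall g1, forall g2, e g1 g2 ==> (index g2 l < index g1 l)].

Definition reverse_linear_extension (l : seq T) : bool :=
  total_order_seq l &&
  [forall g1, forall g2, e g1 g2 ==> (index g1 l < index g2 l)].

Definition extend_D (U D : {set T}) (k : T) : {set T} :=
  if [&& k \notin U, [forall u in U, ~~ e k u] & [forall d in D, ~~ e d k]]
  then k |: D else D.

Definition extend_U (D U : {set T}) (k : T) : {set T} :=
  if [&& k \notin D, [forall d in D, ~~ e d k] & [forall u in U, ~~ e k u]]
  then k |: U else U.

Definition flip (l l' : seq T) (g : T) (P : {set T} * {set T}) :
    {set T} * {set T} :=
  let: (D, U) := P in
  if g \notin D :|: U then P else
  let D0 := [set k in D | ~~ geG g k] in
  let U0 := [set k in U | ~~ geG k g] in
  let D1 := if g \in U then g |: D0 else D0 in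
  let U1 := if g \in D then g |: U0 else U0 in
  let D2 := foldl (extend_D U1) D1 [seq k <- l' | ~~ geG k g] in
  let U2 := foldl (extend_U D2) U1 [seq k <- l | ~~ geG g k] in
  (D2, U2).

(* [Q] is the flip of [P] at some element of U.  The flip does not depend on
   the linear extensions used to compute it, so none is singled out; they are
   tuples of length [#|T|] only to make the quantification finite. *)
Definition flip_up (P Q : top) : bool :=
  [exists g in (val P).2,
   exists l : #|T|.-tuple T, exists l' : #|T|.-tuple T,
     [&& linear_extension l, reverse_linear_extension l'
       & val Q == flip l l' g (val P)]].

(* The order of the independence poset: [connect] is the reflexive and
   transitive closure. *)
Definition top_le : rel top := connect flip_up.

End Tops.

Section Trim.
Local Open Scope order_scope.
Variables (d : Order.disp_t) (L : finLatticeType d).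

Definition chain (A : {set L}) : bool :=
  [forall x in A, forall y in A, x >=< y].

(* A chain with r + 1 elements has length r. *)
Definition longest_chain_length : nat := \max_(A : {set L} | chain A) #|A|.-1.

Definition join_irreducible (j : L) : bool :=
  (~~ [forall x : L, j <= x]) &&
  [forall x : L, forall y : L, (j == x `|` y) ==> (j == x) || (j == y)].

Definition meet_irreducible (m : L) : bool :=
  (~~ [forall x : L, x <= m]) &&
  [forall x : L, forall y : L, (m == x `&` y) ==> (m == x) || (m == y)].

Definition extremal : Prop :=
  longest_chain_length = #|join_irreducible| /\
  longest_chain_length = #|meet_irreducible|.

Definition left_modular_elt (x : L) : Prop :=
  forall y z : L, y <= z -> (y `|` x) `&` z = y `|` (x `&` z).

Definition left_modular : Prop :=
  exists A : {set L}, maxset chain A /\ forall x, x \in A -> left_modular_elt x.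

Definition trim : Prop := extremal /\ left_modular.

End Trim.

(* Main.v *)
Require Import Defs.
From mathcomp Require Import all_boot all_order.
Set Implicit Arguments.
Unset Strict Implicit.
Unset Printing Implicit Defensive.
Import Order.LTheory.

(** Write a top as P = (D, U), and call a pair saturated when it is orthogonal
and every vertex lies in D, lies in U, has an edge into U, or receives an edge
from D.  Saturated pairs are tops, but a tight pair may fail to be saturated:
for a1, a2 -> k -> b1, b2, the pair ({b1, b2}, {a1, a2}) is tight although k
is not blocked by it.  Flips preserve saturation, and the saturated pair with D
empty is never the result of an up-flip; so when top(G) is a lattice this pair
is its minimum, every top is reached from it, and all tops are saturated
([all_saturated]).

A saturated pair is determined by its trace of U on an ideal I and its trace
of D off I ([eq_of_ideal]).  Hence an up-flip at g is the same thing as a pair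
of saturated (D, U), (D', U') with g in U and in D', such that D, D' agree off
the vertices below g and U, U' agree off the vertices above g ([step],
[flip_saturated]).  This description is invariant under reversing edges and
exchanging D with U, which provides every dual statement.

Number the vertices by a rank rk decreasing along edges.  Let j_k be the top
with D = {k}, m_k the top with U = {k}, and x_i the top with no element of U of
rank < i and no element of D of rank >= i.  One pass of down-flips by
decreasing rank shows that j_k <= z whenever k is in D_z, and that x_i <= z
whenever U_z has no element of rank < i; dually y <= m_k whenever k is in U_y.
So each flip y < y' at k satisfies j_k <= y' and y <= m_k, and each x_i
satisfies j_k <= x_i for rk k < i and x_i <= m_k for i <= rk k.

The remaining fact is that j_k <= m_k never holds, and here joins are needed.
If z is above x_i and g, of rank i, is in U_z, then the flip of z at g is
exactly z \/ x_(i+1): D increases lexicographically along the order, which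
leaves no room between the two ([step_least]).  Starting from j_k and joining
with x_0, x_1, ... up to x_(rk k) thus performs flips at vertices of rank less
than rk k, which do not change D from rank rk k upwards.  The result y has k in
D_y and no element of U_y of rank <= rk k, and this last property is inherited
by everything above y but fails for m_k.  As m_k is above each of these x_i, it
would be above y if it were above j_k ([label_nle]).

The rest is lattice theory ([trim_of_labels]).  The x_i form a chain of length
n = #|T|.  Every join-irreducible is a j_k, every meet-irreducible an m_k, and
no chain is longer than the number of join-irreducibles, so the lattice is
extremal.  Each x_i is left modular because any flip at k strictly between
y \/ (x_i /\ z) and (y \/ x_i) /\ z would give j_k <= m_k. *)

(** * Trimness from a labelling of the covers *)


(** Going up a chain strictly enlarges the set of join-irreducibles below: a
minimal element among those below z and not below y is join-irreducible. *)
Lemma height_le_join_irreducible (d : Order.disp_t) (L : finLatticeType d) :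
  longest_chain_length L <= #|@join_irreducible d L|.
Proof.
apply/bigmax_leqP => A /forallP chA.
pose J (y : L) := [set w | join_irreducible w && (w <= y)%O].
have J_mono (y z : L) : (y < z)%O -> J y \proper J z.
  move=> lt_yz; apply/properP; split.
    apply/subsetP => w; rewrite !inE => /andP[-> /=] /le_trans; apply.
    exact: ltW.
  pose S := [pred w : L | (w <= z) && ~~ (w <= y)]%O.
  have Sz : S z by rewrite /= lexx lt_geF.
  case: (@arg_minnP _ z S (fun w : L => #|[set v : L | (v <= w)%O]|) Sz).
  move=> w /andP[le_wz nle_wy] w_min.
  have below_w v : (v < w)%O -> (v <= y)%O.
    move=> lt_vw; apply: contraT => nle_vy.
    have /w_min : S v by rewrite /= nle_vy (le_trans (ltW lt_vw)).
    rewrite leqNgt => /negP[]; apply: proper_card; apply/properP; split.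
      by apply/subsetP => u; rewrite !inE => /le_trans; apply; exact: ltW.
    by exists w; rewrite !inE ?lexx // lt_geF.
  exists w; rewrite !inE ?(negPf nle_wy) ?andbF // le_wz andbT.
  apply/andP; split.
    by apply/negP => /forallP/(_ y); rewrite (negPf nle_wy).
  apply/forallP => a; apply/forallP => b; apply/implyP => /eqP def_w.
  apply: contraT; rewrite negb_or => /andP[ne_wa ne_wb].
  case/negP: nle_wy; rewrite def_w leUx !below_w //.
    by rewrite lt_def ne_wb def_w leUr.
  by rewrite lt_def ne_wa def_w leUl.
have J_inj : {in A &, injective (fun y => inord #|J y| : 'I_#|@join_irreducible d L|.+1)}.
  have J_bound y : #|J y| < #|@join_irreducible d L|.+1.
    by rewrite ltnS; apply/subset_leq_card/subsetP=> w; rewrite inE => /andP[].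
  move=> y z Ay Az /(congr1 val) /=; rewrite !inordK // => eq_card.
  have := chA y; rewrite Ay => /forallP/(_ z); rewrite Az /=.
  by case: (comparableP y z) => // /J_mono/proper_card; rewrite eq_card ltnn.
suff : #|A| <= #|@join_irreducible d L|.+1 by case: #|A|.
rewrite -(card_in_imset J_inj).
by apply: (leq_trans (max_card _)); rewrite card_ord.
Qed.

Lemma height_le_meet_irreducible (d : Order.disp_t) (L : finLatticeType d) :
  longest_chain_length L <= #|@meet_irreducible d L|.
Proof.
suff <- : longest_chain_length L^d = longest_chain_length L.
  exact: (@height_le_join_irreducible _ (L^d)%O).
apply: eq_bigl => A; apply: eq_forallb => x; congr (_ ==> _).
by apply: eq_forallb => y; congr (_ ==> _); apply: orbC.
Qed.

(** A join-irreducible z has a unique lower cover y, and the label k of the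
step from y to z satisfies j k = z: otherwise j k would be below y, hence below
m k. *)
Lemma join_irreducible_le_labels (d : Order.disp_t) (L : finLatticeType d)
    (T : finType) (j m : T -> L) :
  (forall k, ~~ (j k <= m k)%O) ->
  (forall y z, (y < z)%O -> exists k z', [/\ y <= z', z' <= z, j k <= z & z' <= m k]%O) ->
  #|@join_irreducible d L| <= #|T|.
Proof.
move=> j_nle_m cover_below.
suff /subset_leq_card : @join_irreducible d L \subset codom j.
  by move/leq_trans; apply; rewrite (leq_trans (card_size _)) // size_codom.
apply/subsetP => z /andP[nbot /forallP z_irr].
have [y0 nle_zy0] : exists y0, ~~ (z <= y0)%O.
  by move: nbot; rewrite negb_forall => /existsP.
have lt_z0 : (z `&` y0 < z)%O.
  by rewrite lt_neqAle leIl andbT; apply: contra nle_zy0 => /eqP <-; rewrite leIr.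
(* y is the lower cover of z, chosen as an element below z with as many
   elements as possible below it. *)
case: (@arg_maxnP _ (z `&` y0)%O (fun y => y < z)%O
          (fun y : L => #|[set v : L | (v <= y)%O]|) lt_z0).
move=> y lt_yz y_max.
have y_lower w : (w < z)%O -> (w <= y)%O.
  move=> lt_wz.
  have lt_yw : (y `|` w < z)%O.
    rewrite lt_neqAle leUx (ltW lt_yz) (ltW lt_wz) /= andbT; apply/eqP => def_z.
    have /forallP/(_ w) := z_irr y.
    by rewrite -def_z eqxx /= def_z !(gt_eqF lt_yz, gt_eqF lt_wz).
  apply: contraT => nle_wy; have /= := y_max _ lt_yw; rewrite leqNgt => /negP[].
  apply: proper_card; apply/properP; split.
    by apply/subsetP => u; rewrite !inE => /le_trans; apply; exact: leUl.
  by exists w; rewrite !inE // leUr.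
have [k [z' [le_yz' le_z'z le_jz le_z'm]]] := cover_below _ _ lt_yz.
apply/codomP; exists k; apply/eqP; rewrite eq_sym; apply: contraT => ne_jz.
have := j_nle_m k; rewrite (le_trans _ le_z'm) // (le_trans _ le_yz') //.
by apply: y_lower; rewrite lt_neqAle ne_jz.
Qed.

(** With a = y \/ (x /\ z) <= b = (y \/ x) /\ z one has x \/ a = x \/ b and
x /\ a = x /\ b.  If a < b, a step from a towards b with label k contradicts
the former when x <= m k, and the latter when j k <= x. *)
Lemma left_modular_of_labels (d : Order.disp_t) (L : finLatticeType d)
    (T : finType) (j m : T -> L) (x : L) :
  (forall k, ~~ (j k <= m k)%O) ->
  (forall y z, (y < z)%O -> exists k y', [/\ y <= y', y' <= z, j k <= y' & y <= m k]%O) ->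
  (forall k, (j k <= x) || (x <= m k))%O ->
  left_modular_elt x.
Proof.
move=> j_nle_m cover_above x_splits y z le_yz.
set a := (y `|` (x `&` z))%O; set b := ((y `|` x) `&` z)%O.
have le_ab : (a <= b)%O.
  by rewrite leUx !lexI leUl le_yz leIr (le_trans (leIl _ _)) ?leUr.
have [//|] := eqVneq b a; rewrite eq_sym => ne_ab.
have [|k [a' [le_aa' le_a'b le_ja' le_am]]] := cover_above a b.
  by rewrite lt_neqAle ne_ab.
have := j_nle_m k; have /orP[le_jx|le_xm] := x_splits k.
  rewrite (le_trans _ le_am) // (le_trans _ (leUr _ _)) // lexI le_jx /=.
  by rewrite (le_trans le_ja') // (le_trans le_a'b) // leIr.
rewrite (le_trans le_ja') // (le_trans le_a'b) // (le_trans (leIl _ _)) //.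
by rewrite leUx le_xm (le_trans (leUl _ _) le_am).
Qed.

(** The two conditions on y < z are dual to each other: the first supplies a
labelled step starting at y, the second one ending at z. *)
Theorem trim_of_labels (d : Order.disp_t) (L : finLatticeType d)
    (T : finType) (rk : T -> nat) (j m : T -> L) (x : 'I_#|T|.+1 -> L) :
  (forall i, i < #|T| -> exists k, rk k = i) ->
  (forall k, ~~ (j k <= m k)%O) ->
  (forall y z, (y < z)%O -> exists k y', [/\ y <= y', y' <= z, j k <= y' & y <= m k]%O) ->
  (forall y z, (y < z)%O -> exists k z', [/\ y <= z', z' <= z, j k <= z & z' <= m k]%O) ->
  {homo x : i i' / i <= i' >-> (i <= i')%O} ->
  (forall k (i : 'I_#|T|.+1), if rk k < i then (j k <= x i)%O else (x i <= m k)%O) ->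
  trim L.
Proof.
move=> rk_onto j_nle_m cover_above cover_below x_mono x_splits.
have JI_le : #|@join_irreducible d L| <= #|T|.
  exact: join_irreducible_le_labels j_nle_m cover_below.
have MI_le : #|@meet_irreducible d L| <= #|T|.
  apply: (@join_irreducible_le_labels _ (L^d)%O T m j) => // y z /cover_above.
  by case=> k [y' [? ? ? ?]]; exists k, y'.
pose A := [set x i | i : 'I_#|T|.+1].
have chA : chain A.
  apply/forallP => ?; apply/implyP => /imsetP[i _ ->].
  apply/forallP => ?; apply/implyP => /imsetP[i' _ ->].
  by rewrite /Order.comparable; have [/x_mono->|/ltnW/x_mono->] := leqP i i'; rewrite ?orbT.
have x_inj : injective x.
  suff x_lt (i i' : 'I_#|T|.+1) : i < i' -> x i != x i'.
    move=> i i' eq_x; apply: val_inj => /=.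
    by case: (ltngtP i i') => // /x_lt; rewrite eq_x eqxx.
  move=> lt_ii'; have [k rk_k] : exists k, rk k = i.
    by apply: rk_onto; rewrite (leq_trans lt_ii') // -ltnS.
  have := x_splits k i; have := x_splits k i'; rewrite rk_k lt_ii' ltnn.
  move=> le_jx le_xm; apply: contra (j_nle_m k) => /eqP eq_x.
  by rewrite (le_trans le_jx) // -eq_x.
have cardA : #|A| = #|T|.+1 by rewrite card_imset // card_ord.
have height : longest_chain_length L = #|T|.
  apply/eqP; rewrite eqn_leq (leq_trans (height_le_join_irreducible L)) //=.
  by rewrite -[#|T|]/(#|T|.+1.-1) -cardA; apply: leq_bigmax_cond.
split.
  split; rewrite height; apply/eqP; rewrite eqn_leq ?JI_le ?MI_le andbT -height.
    exact: height_le_join_irreducible.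
  exact: height_le_meet_irreducible.
exists A; split.
  apply/maxsetP; split=> // B chB sAB; apply/esym/eqP.
  rewrite eqEcard sAB cardA (leq_trans (leqSpred _)) // ltnS -height.
  exact: leq_bigmax_cond.
move=> _ /imsetP[i _ ->]; apply: (left_modular_of_labels j_nle_m) => // k.
by have := x_splits k i; case: ifP => _ ->; rewrite ?orbT.
Qed.
(** * Saturated pairs *)

Section Pairs.
Variable T : finType.
Implicit Types (e : rel T) (D U : {set T}) (P Q R : {set T} * {set T}) (rk : T -> nat).

Definition op e : rel T := fun x y => e y x.
Definition swap P : {set T} * {set T} := (P.2, P.1).

Record ranking e rk : Prop := Ranking {
  ranking_inj : injective rk;
  ranking_bound : forall x, rk x < #|T|;
  ranking_edge : forall x y, e x y -> rk y < rk x }.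

Lemma ranking_op e rk :
    ranking e rk -> ranking (op e) (fun x => #|T| - (rk x).+1).
Proof.
case=> rk_inj rk_b rk_e; split=> [x y eq_xy|x|x y /rk_e lt_xy].
- apply: rk_inj; apply: succn_inj.
  by rewrite -(subKn (rk_b x)) eq_xy subKn.
- by rewrite ltn_subrL (leq_ltn_trans _ (rk_b x)).
- apply: ltn_sub2l; rewrite ?ltnS //; exact: leq_ltn_trans lt_xy (rk_b y).
Qed.

Lemma ranking_connect e rk x y : ranking e rk -> connect e x y -> x = y \/ rk y < rk x.
Proof.
move=> rkP /connectP[p + ->]; elim: p x => [|z p IHp] x /=; first by left.
case/andP=> /(ranking_edge rkP) lt_zx /IHp[<-|lt_]; right=> //.
exact: ltn_trans lt_zx.
Qed.

Record saturated e P : Prop := Saturated {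
  sat_disj : forall x, x \in P.1 -> x \in P.2 -> False;
  sat_D : forall x y, x \in P.1 -> y \in P.1 -> ~~ e x y;
  sat_U : forall x y, x \in P.2 -> y \in P.2 -> ~~ e x y;
  sat_DU : forall x y, x \in P.1 -> y \in P.2 -> ~~ e x y;
  sat_cover : forall k, [\/ k \in P.1, k \in P.2,
    exists2 u, u \in P.2 & e k u | exists2 d, d \in P.1 & e d k] }.

Lemma saturated_op e P : saturated e P -> saturated (op e) (swap P).
Proof.
case=> disj indD indU indDU cov; split=> /=; first by move=> x /[swap]; apply: disj.
- by move=> x y xU yU; apply: indU.
- by move=> x y xD yD; apply: indD.
- by move=> x y xU yD; apply: indDU.
by move=> k; case: (cov k) => ?; [apply: Or42|apply: Or41|apply: Or44|apply: Or43].
Qed.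

(** Membership in D is thus decided by U and by the elements of D that come
before k when edges are followed: a saturated pair is a greedy one. *)
Lemma saturated_inD e P k : saturated e P ->
  (k \in P.1) = [&& k \notin P.2, [forall u in P.2, ~~ e k u] & [forall d in P.1, ~~ e d k]].
Proof.
move=> satP; apply/idP/and3P => [kD|[kU /forall_inP kPU /forall_inP kPD]].
  split; first by apply/negP; apply: sat_disj satP _ kD.
    by apply/forall_inP => u; apply: sat_DU satP _ _ kD.
  by apply/forall_inP => d' d'D; apply: sat_D satP _ _ d'D kD.
case: (sat_cover satP k) => // [|[u /kPU/negP]//|[d' /kPD/negP]//].
by rewrite (negPf kU).
Qed.

(** On I, the elements of D are determined greedily, by decreasing rank: the
vertices that an element of I points to are in I, where U is prescribed. *)
Lemma eq_D_of_ideal e rk P Q (I : pred T) : ranking e rk ->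
  saturated e P -> saturated e Q -> (forall x y, e x y -> I x -> I y) ->
  (forall x, I x -> (x \in P.2) = (x \in Q.2)) ->
  (forall x, ~~ I x -> (x \in P.1) = (x \in Q.1)) ->
  P.1 = Q.1.
Proof.
move=> rkP satP satQ idealI eqU eqD; apply/setP => x.
have [n] := ubnP (#|T| - rk x); elim: n x => // n IHn x; rewrite ltnS => le_n.
have [Ix|/eqD//] := boolP (I x).
rewrite (saturated_inD x satP) (saturated_inD x satQ) eqU //; congr [&& _, _ & _].
  apply: eq_forallb => u; have [exu|] := boolP (e x u); last by rewrite !implybT.
  by rewrite eqU // (idealI x).
apply: eq_forallb => y; have [eyx|] := boolP (e y x); last by rewrite !implybT.
rewrite IHn // (leq_trans _ le_n) // ltn_sub2l ?(ranking_bound rkP) //.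
exact: ranking_edge eyx.
Qed.

Lemma eq_of_ideal e rk P Q (I : pred T) : ranking e rk ->
  saturated e P -> saturated e Q -> (forall x y, e x y -> I x -> I y) ->
  (forall x, I x -> (x \in P.2) = (x \in Q.2)) ->
  (forall x, ~~ I x -> (x \in P.1) = (x \in Q.1)) ->
  P = Q.
Proof.
move=> rkP satP satQ idealI eqU eqD; rewrite [P]surjective_pairing [Q]surjective_pairing.
rewrite (eq_D_of_ideal rkP satP satQ idealI) //; congr (_, _).
apply: (@eq_D_of_ideal (op e) _ (swap P) (swap Q) (predC I) (ranking_op rkP)).
- exact: saturated_op.
- exact: saturated_op.
- by move=> x y eyx /=; apply: contra; apply: idealI.
- exact: eqD.
- by move=> x; rewrite negbK; apply: eqU.
Qed.

(** No element can be added, as it is blocked.  An exchange of d for d' > d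
would require d' to be blocked by d only, that is d -> d', against
acyclicity. *)
Lemma saturated_is_top e rk P : ranking e rk -> saturated e P -> is_top e P.
Proof.
move=> rkP satP; have [disj indD indU indDU cov] := satP.
have orthP : orthogonal e P.
  apply/and4P; split.
  - by apply/pred0P => x /=; apply/andP => -[/disj].
  - by apply/forall_inP => x xD; apply/forall_inP => y; apply: indD.
  - by apply/forall_inP => x xD; apply/forall_inP => y; apply: indU.
  - by apply/forall_inP => x xD; apply/forall_inP => y; apply: indDU.
have orthW (D U : {set T}) : orthogonal e (D, U) ->
  [/\ forall x, x \in D -> x \in U -> False,
      forall x y, x \in D -> y \in D -> ~~ e x y,
      forall x y, x \in U -> y \in U -> ~~ e x y &
      forall x y, x \in D -> y \in U -> ~~ e x y].
  case/and4P=> /pred0P dis /forall_inP iD /forall_inP iU /forall_inP iDU.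
  split=> [x xD xU|x y xD yD|x y xD yD|x y xD yD].
  - by have := dis x; rewrite /= xD xU.
  - by have /forall_inP := iD x xD; apply.
  - by have /forall_inP := iU x xD; apply.
  - by have /forall_inP := iDU x xD; apply.
have ngt x y z : gtG e x y -> z = y -> e z x -> False.
  case/andP=> ne_xy /(ranking_connect rkP)[eq_xy|lt_] -> /(ranking_edge rkP) lt_'.
    by rewrite eq_xy eqxx in ne_xy.
  by have := ltn_trans lt_ lt_'; rewrite ltnn.
rewrite /is_top orthP /=.
case: P {satP orthP} disj indD indU indDU cov => D U /= disj indD indU indDU cov.
apply/and4P; split.
- apply/forall_inP => x xD; apply/forallP => x'; apply/implyP => /andP[x'D gtx].
  apply/negP => /orthW[dis iD iU iDU].
  have x'D' : x' \in x' |: D :\ x by rewrite setU11.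
  case: (cov x') => [|x'U|[u uU eu]|[y yD ey]]; first exact/negP.
  + exact: dis x'D' x'U.
  + by have := iDU _ _ x'D' uU; rewrite eu.
  have [eq_yx|ne_yx] := eqVneq y x; first exact: ngt gtx eq_yx ey.
  have /iD/(_ x'D') : y \in x' |: D :\ x by rewrite !inE ne_yx yD orbT.
  by rewrite ey.
- apply/forall_inP => x xD; apply/forallP => x'; apply/implyP => /andP[x'D gtx].
  apply/negP => /orthW[dis iD iU iDU].
  have x'D' : x' \in x' |: U :\ x by rewrite setU11.
  case: (cov x') => [x'U||[y yD ey]|[u uU eu]].
  + exact: dis x'U x'D'.
  + exact/negP.
  + have [eq_yx|ne_yx] := eqVneq y x.
      case/andP: gtx => ne_xy /(ranking_connect rkP)[eq_xy|lt_].
        by rewrite eq_xy eqxx in ne_xy.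
      move: ey; rewrite eq_yx => /(ranking_edge rkP) lt_'.
      by have := ltn_trans lt_ lt_'; rewrite ltnn.
    have /(iU _ _ x'D') : y \in x' |: U :\ x by rewrite !inE ne_yx yD orbT.
    by rewrite ey.
  by have := iDU _ _ uU x'D'; rewrite eu.
- apply/forallP => x; apply/implyP => xD; apply/negP => /orthW[dis iD iU iDU].
  have xD' : x \in x |: D by rewrite setU11.
  case: (cov x) => [|xU|[u uU eu]|[y yD ey]]; first exact/negP.
  + exact: dis xD' xU.
  + by have := iDU _ _ xD' uU; rewrite eu.
  by have := iD y x; rewrite setU1r // ey => /(_ isT xD').
- apply/forallP => x; apply/implyP => xD; apply/negP => /orthW[dis iD iU iDU].
  have xD' : x \in x |: U by rewrite setU11.
  case: (cov x) => [xU||[u uU eu]|[y yD ey]].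
  + exact: dis xU xD'.
  + exact/negP.
  + by have := iU x u xD'; rewrite setU1r // eu => /(_ isT).
  by have := iDU y x yD xD'; rewrite ey.
Qed.

(** The greedy loop.  The order condition on s makes independence hold: a
vertex is only tested for edges into the current set, and none of the vertices
added before it can point to it.  The test does not see edges out of U0, so the
second clause only speaks of edges out of an added vertex. *)
Lemma foldl_extend_U e D s U0 (V := foldl (extend_U e D) U0 s) :
  (forall x, ~~ e x x) -> pairwise (fun a b => ~~ e a b) s ->
  [/\ {subset U0 <= V},
      forall x, x \in V -> x \notin U0 -> [/\ x \in s, x \notin D,
        forall y, y \in D -> ~~ e y x & forall y, y \in V -> ~~ e x y] &
      forall x, x \in s -> [\/ x \in D, x \in V,
        exists2 u, u \in V & e x u | exists2 y, y \in D & e y x]].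
Proof.
rewrite /V {V} => irr; elim: s U0 => [|a s IHs] U0 /=.
  by move=> _; split=> // x -> .
case/andP=> /allP a_s /IHs; set U1 := extend_U e D U0 a => /(_ U1).
set V := foldl _ _ _ => -[sub1 new cov].
have sub01 : {subset U0 <= U1}.
  by move=> x xU; rewrite /U1 /extend_U; case: ifP => // _; rewrite setU1r.
split=> [x /sub01/sub1//|x xV xU0|x].
  have [xU1|xU1] := boolP (x \in U1); last first.
    by have [xs ? ? ?] := new x xV xU1; split; rewrite // inE xs orbT.
  move: xU1 (xU1); rewrite {1}/U1 /extend_U; case: ifP => [|_]; last by rewrite (negPf xU0).
  case/and3P=> aD /forall_inP aPD /forall_inP aPU; rewrite !inE (negPf xU0) orbF.
  move=> /eqP -> aU1; rewrite eqxx; split=> // y yV.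
  have [yU1|yU1] := boolP (y \in U1); last by have [/a_s] := new y yV yU1.
  have [/aPU//|yU0] := boolP (y \in U0).
  move: yU1; rewrite /U1 /extend_U; case: ifP => _; rewrite ?inE (negPf yU0) // orbF.
  by move/eqP->; apply: irr.
rewrite inE => /predU1P[->|/cov//].
have [aU1|aU1] := boolP (a \in U1); first by apply: Or42; apply: sub1.
move: aU1; rewrite /U1 /extend_U; case: ifP => [|/negbT]; first by rewrite setU11.
rewrite !negb_and negbK => /or3P[aD _|/forall_inPn[y yD]|/forall_inPn[y yU]].
- exact: Or41.
- by rewrite negbK => eya _; apply: Or44; exists y.
- by rewrite negbK => eay _; apply: Or43; exists y => //; apply/sub1/sub01.
Qed.

Lemma foldl_extend_D e U s D0 (V := foldl (extend_D e U) D0 s) :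
  (forall x, ~~ e x x) -> pairwise (fun a b => ~~ e b a) s ->
  [/\ {subset D0 <= V},
      forall x, x \in V -> x \notin D0 -> [/\ x \in s, x \notin U,
        forall y, y \in U -> ~~ e x y & forall y, y \in V -> ~~ e y x] &
      forall x, x \in s -> [\/ x \in U, x \in V,
        exists2 u, u \in V & e u x | exists2 y, y \in U & e x y]].
Proof. exact: (@foldl_extend_U (op e)). Qed.


(** * Flips *)

Lemma connect_op e x y : connect (op e) x y = connect e y x.
Proof. exact: (connect_rev e). Qed.

(** A description of the flip at g in U that exhibits its inverse and is
self-dual; see [flip_step_up] and [flip_step_down]. *)
Record step e g P Q : Prop := Step {
  step_src : saturated e P;
  step_tgt : saturated e Q;
  step_U : g \in P.2;
  step_D : g \in Q.1;
  step_eqD : forall x, ~~ connect e g x -> (x \in P.1) = (x \in Q.1);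
  step_eqU : forall x, ~~ connect e x g -> (x \in P.2) = (x \in Q.2) }.

Lemma step_op e g P Q : step e g P Q -> step (op e) g (swap Q) (swap P).
Proof.
case=> satP satQ gU gD eqD eqU; split=> //; try exact: saturated_op.
  by move=> x; rewrite connect_op => /eqU.
by move=> x; rewrite connect_op => /eqD.
Qed.

(** The vertices not above g form an ideal; U is prescribed on it, and D off
it. *)
Lemma step_uniq e rk g P Q Q' : ranking e rk -> step e g P Q -> step e g P Q' -> Q = Q'.
Proof.
move=> rkP [satP satQ gU gD eqD eqU] [_ satQ' _ gD' eqD' eqU'].
apply: (@eq_of_ideal e rk _ _ (fun x => ~~ connect e x g)) => //.
- move=> x y exy; apply: contra => /(connect_trans _); apply; exact: connect1.
- by move=> x Nxg; rewrite -eqU // eqU'.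
move=> x; rewrite negbK => /(ranking_connect rkP)[->|lt_gx]; first by rewrite gD gD'.
have Ngx : ~~ connect e g x.
  apply/negP => /(ranking_connect rkP)[eq_xg|lt_]; first by rewrite eq_xg ltnn in lt_gx.
  by have := ltn_trans lt_ lt_gx; rewrite ltnn.
by rewrite -eqD // eqD'.
Qed.

Lemma linear_extension_pairwise e l : linear_extension e l ->
  pairwise (fun a b => ~~ e a b) l.
Proof.
case/andP=> /andP[ul _] /forallP le_l; case: l ul le_l => [//|x0 l] ul le_l.
apply/(pairwiseP x0) => i j ilt jlt lt_ij; apply/negP => eij.
have /forallP/(_ (nth x0 (x0 :: l) j)) := le_l (nth x0 (x0 :: l) i).
by rewrite eij !index_uniq //= ltnNge ltnW.
Qed.

Lemma reverse_linear_extension_pairwise e l : reverse_linear_extension e l ->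
  pairwise (fun a b => ~~ e b a) l.
Proof.
case/andP=> ul /forallP le_l; apply: (@linear_extension_pairwise (op e)).
rewrite /linear_extension ul /=; apply/forallP => x; apply/forallP => y.
by have /forallP := le_l y; apply.
Qed.

(** The point is that the loops only add to D vertices below g, and to U
vertices above g.  A vertex blocked in P remains so unless what blocked it was
removed, that is, unless it is itself below or above g as appropriate. *)
Lemma flip_saturated e rk l l' g P (Q := flip e l l' g P) :
  ranking e rk -> saturated e P -> linear_extension e l ->
  reverse_linear_extension e l' -> g \in P.1 :|: P.2 ->
  [/\ saturated e Q, (g \in Q.1) = (g \in P.2), (g \in Q.2) = (g \in P.1),
      forall x, ~~ connect e g x -> (x \in P.1) = (x \in Q.1) &
      forall x, ~~ connect e x g -> (x \in P.2) = (x \in Q.2)].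
Proof.
move=> rkP; rewrite {}/Q; case: P => D U satP lext lext' /=.
have [/= disj indD indU indDU cov] := satP => gDU; rewrite gDU /=.
have all_l x : x \in l by case/andP: lext => /andP[_ /forallP].
have all_l' x : x \in l' by case/andP: lext' => /andP[_ /forallP].
have pw_l := linear_extension_pairwise lext.
have pw_l' := reverse_linear_extension_pairwise lext'.
have irr x : ~~ e x x by apply/negP => /(ranking_edge rkP); rewrite ltnn.
have cyc x y : connect e x y -> connect e y x -> x = y.
  move=> /(ranking_connect rkP)[//|lt_] /(ranking_connect rkP)[//|lt_'].
  by have := ltn_trans lt_ lt_'; rewrite ltnn.
have edge_cyc x y : e x y -> connect e y x -> False.
  move=> exy cyx; have eq_xy := cyc _ _ (connect1 exy) cyx.
  by have := irr x; rewrite {2}eq_xy exy.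
rewrite /geG; set D0 := [set k in D | _]; set U0 := [set k in U | _].
set D1 := (if g \in U then g |: D0 else D0); set U1 := (if g \in D then g |: U0 else U0).
have inD1 x : (x \in D1) = (x == g) && (g \in U) || (x \in D) && ~~ connect e g x.
  rewrite /D1; case: ifP => _; rewrite !inE ?andbT ?andbF //.
have inU1 x : (x \in U1) = (x == g) && (g \in D) || (x \in U) && ~~ connect e x g.
  by rewrite /U1; case: ifP => _; rewrite !inE ?andbT ?andbF.
set sD := [seq k <- l' | _]; set sU := [seq k <- l | _].
have pw_sD : pairwise (fun a b => ~~ e b a) sD
  by apply: subseq_pairwise pw_l'; apply: filter_subseq.
have pw_sU : pairwise (fun a b => ~~ e a b) sU
  by apply: subseq_pairwise pw_l; apply: filter_subseq.
have in_sD x : (x \in sD) = ~~ connect e x g by rewrite mem_filter all_l' andbT.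
have in_sU x : (x \in sU) = ~~ connect e g x by rewrite mem_filter all_l andbT.
have [] := foldl_extend_D U1 D1 irr pw_sD; set D2 := foldl _ _ sD => subD newD covD.
have [] := foldl_extend_U D2 U1 irr pw_sU; set U2 := foldl _ _ sU => subU newU covU.
(* In each case of [cov], x was blocked by some element of D or U; unless x is
   below g, that element is kept and still forbids adding x. *)
have newD_lt x : x \in D2 -> x \notin D1 -> connect e g x.
  move=> xD2 xD1; have [xg xU1 x_U1 x_D2] := newD x xD2 xD1.
  rewrite in_sD in xg; apply: contraT => gx.
  case: (cov x) => [xD|xU|[u uU eu]|[y yD ey]].
  - by rewrite inD1 xD gx orbT in xD1.
  - by rewrite inU1 xU xg orbT in xU1.
  - have [ug|ug] := boolP (connect e u g).
      by rewrite (connect_trans (connect1 eu) ug) in xg.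
    by have := x_U1 u; rewrite inU1 uU ug orbT eu => /(_ isT).
  have [gy|gy] := boolP (connect e g y).
    by rewrite (connect_trans gy (connect1 ey)) in gx.
  by have := x_D2 y; rewrite subD ?inD1 ?yD ?gy ?orbT // ey => /(_ isT).
have newU_gt x : x \in U2 -> x \notin U1 -> connect e x g.
  move=> xU2 xU1; have [gx xD2 x_D2 x_U2] := newU x xU2 xU1.
  rewrite in_sU in gx; apply: contraT => xg.
  case: (cov x) => [xD|xU|[u uU eu]|[y yD ey]].
  - by rewrite subD ?inD1 ?xD ?gx ?orbT in xD2.
  - by rewrite inU1 xU xg orbT in xU1.
  - have [ug|ug] := boolP (connect e u g).
      by rewrite (connect_trans (connect1 eu) ug) in xg.
    by have := x_U2 u; rewrite subU ?inU1 ?uU ?ug ?orbT // eu => /(_ isT).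
  have [gy|gy] := boolP (connect e g y).
    by rewrite (connect_trans gy (connect1 ey)) in gx.
  by have := x_D2 y; rewrite subD ?inD1 ?yD ?gy ?orbT // ey => /(_ isT).
have gD2 : (g \in D2) = (g \in U).
  apply/idP/idP => [gD2|gU]; last by rewrite subD // inD1 eqxx gU.
  have [|gD1] := boolP (g \in D1); first by rewrite inD1 eqxx connect0 andbF orbF.
  by have [] := newD g gD2 gD1; rewrite in_sD connect0.
have gU2 : (g \in U2) = (g \in D).
  apply/idP/idP => [gU2|gD]; last by rewrite subU // inU1 eqxx gD.
  have [|gU1] := boolP (g \in U1); first by rewrite inU1 eqxx connect0 andbF orbF.
  by have [] := newU g gU2 gU1; rewrite in_sU connect0.
have eqD x : ~~ connect e g x -> (x \in D) = (x \in D2).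
  move=> gx; have ne_xg : (x == g) = false by apply: contraNF gx => /eqP->.
  apply/idP/idP => [xD|xD2]; first by rewrite subD // inD1 xD gx orbT.
  have [|xD1] := boolP (x \in D1); first by rewrite inD1 ne_xg gx andbT.
  by rewrite (newD_lt x) in gx.
have eqU x : ~~ connect e x g -> (x \in U) = (x \in U2).
  move=> xg; have ne_xg : (x == g) = false by apply: contraNF xg => /eqP->.
  apply/idP/idP => [xU|xU2]; first by rewrite subU // inU1 xU xg orbT.
  have [|xU1] := boolP (x \in U1); first by rewrite inU1 ne_xg xg andbT.
  by rewrite (newU_gt x) in xg.
split=> //.
have D1_cases x : x \in D1 -> (x = g /\ g \in U) \/ (x \in D /\ ~~ connect e g x).
  by rewrite inD1 => /orP[/andP[/eqP]|/andP[]]; [left|right].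
have U1_cases x : x \in U1 -> (x = g /\ g \in D) \/ (x \in U /\ ~~ connect e x g).
  by rewrite inU1 => /orP[/andP[/eqP]|/andP[]]; [left|right].
have gDU' : g \in D -> g \in U -> False by apply: disj.
have D2U1 x y : x \in D2 -> y \in U1 -> ~~ e x y.
  move=> xD2 yU1; have [xD1|xD1] := boolP (x \in D1); last by have [_ _ + _] := newD x xD2 xD1; apply.
  have [[-> gU]|[xD gx]] := D1_cases _ xD1; have [[-> gD]|[yU yg]] := U1_cases _ yU1.
  - exact: irr.
  - exact: indU.
  - exact: indD.
  - exact: indDU.
(* The only edges not excluded when x was inserted are those from a new x to
   some y already in D1; as x is below g, so would y be. *)
have D2D2 x y : x \in D2 -> y \in D2 -> ~~ e x y.
  move=> xD2 yD2; have [yD1|yD1] := boolP (y \in D1); last by have [_ _ _] := newD y yD2 yD1; apply.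
  have [xD1|xD1] := boolP (x \in D1).
    have [[-> gU]|[xD gx]] := D1_cases _ xD1; have [[-> gU']|[yD gy]] := D1_cases _ yD1.
    + exact: irr.
    + by apply: contra gy; apply: connect1.
    + exact: indDU.
    + exact: indD.
  have gx := newD_lt x xD2 xD1; apply/negP => exy.
  have [[eq_yg gU]|[yD gy]] := D1_cases _ yD1.
    by apply: (edge_cyc _ _ exy); rewrite eq_yg.
  by rewrite (connect_trans gx (connect1 exy)) in gy.
have U2U2 x y : x \in U2 -> y \in U2 -> ~~ e x y.
  move=> xU2 yU2; have [xU1|xU1] := boolP (x \in U1); last by have [_ _ _] := newU x xU2 xU1; apply.
  have [yU1|yU1] := boolP (y \in U1).
    have [[-> gD]|[xU xg]] := U1_cases _ xU1; have [[-> gD']|[yU yg]] := U1_cases _ yU1.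
    + exact: irr.
    + exact: indDU.
    + by apply: contra xg; apply: connect1.
    + exact: indU.
  have yg := newU_gt y yU2 yU1; apply/negP => exy.
  have [[eq_xg gD]|[xU xg]] := U1_cases _ xU1.
    by apply: (edge_cyc _ _ exy); rewrite eq_xg.
  by rewrite (connect_trans (connect1 exy) yg) in xg.
have D2U2 x y : x \in D2 -> y \in U2 -> ~~ e x y.
  move=> xD2 yU2; have [yU1|yU1] := boolP (y \in U1); first exact: D2U1.
  by have [_ _ + _] := newU y yU2 yU1; apply.
split=> //=.
- move=> x xD2 xU2; have [xU1|xU1] := boolP (x \in U1); last first.
    by have [_] := newU x xU2 xU1; rewrite xD2.
  have [xD1|xD1] := boolP (x \in D1); last first.
    by have [_] := newD x xD2 xD1; rewrite xU1.
  have [[eq_xg' gU]|[xD gx]] := D1_cases _ xD1; have [[eq_xg gD]|[xU xg]] := U1_cases _ xU1.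
  + exact: gDU'.
  + by rewrite eq_xg' connect0 in xg.
  + by rewrite eq_xg connect0 in gx.
  + exact: disj xD xU.
(* Every vertex other than g is scanned by one of the two loops, since it
   cannot be both above and below g. *)
move=> k; have [kg|kg] := boolP (connect e k g); last first.
  have /covD[kU1|kD2|[y yD2 ey]|[u uU1 eu]] : k \in sD by rewrite in_sD.
  - by apply/Or42/subU.
  - exact: Or41.
  - by apply: Or44; exists y.
  - by apply: Or43; exists u => //; apply: subU.
have [gk|gk] := boolP (connect e g k).
  rewrite (cyc _ _ kg gk) gD2 gU2.
  by move: gDU; rewrite inE => /orP[]; [apply: Or42|apply: Or41].
have /covU[kD2|kU2|[u uU2 eu]|[y yD2 ey]] : k \in sU by rewrite in_sU.
- exact: Or41.
- exact: Or42.
- by apply: Or43; exists u.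
- by apply: Or44; exists y.
Qed.

Lemma flip_step_up e rk l l' g P : ranking e rk -> saturated e P ->
  linear_extension e l -> reverse_linear_extension e l' -> g \in P.2 ->
  step e g P (flip e l l' g P).
Proof.
move=> rkP satP lext lext' gU.
have [|satQ gD _ eqD eqU] := flip_saturated rkP satP lext lext' (g := g).
  by rewrite inE gU orbT.
by split; rewrite // gD.
Qed.

Lemma flip_step_down e rk l l' g P : ranking e rk -> saturated e P ->
  linear_extension e l -> reverse_linear_extension e l' -> g \in P.1 ->
  step e g (flip e l l' g P) P.
Proof.
move=> rkP satP lext lext' gD.
have [|satQ _ gU eqD eqU] := flip_saturated rkP satP lext lext' (g := g).
  by rewrite inE gD.
by split; rewrite // ?gU // => x; [move/eqD|move/eqU].
Qed.

Lemma sort_linear_extension e (key : T -> nat) :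
  (forall x y, e x y -> key y < key x) ->
  linear_extension e (sort (fun a b => key a <= key b) (enum T)).
Proof.
move=> key_e; set leK := fun a b => _; set l := sort _ _.
have all_l x : x \in l by rewrite mem_sort mem_enum.
apply/andP; split; first by rewrite /total_order_seq sort_uniq enum_uniq; apply/forallP.
apply/forallP => x; apply/forallP => y; apply/implyP => /key_e lt_yx.
rewrite ltnNge; apply: contraTN lt_yx => le_xy; rewrite -leqNgt.
have trK : transitive leK by move=> b a c; apply: leq_trans.
have reK : reflexive leK by move=> a; apply: leqnn.
have soK : sorted leK l by apply: sort_sorted => a b; apply: leq_total.
exact: (sorted_leq_index trK reK soK).
Qed.

Lemma total_order_seq_size (l : seq T) : total_order_seq l -> size l == #|T|.
Proof.
case/andP=> ul /forallP all_l; rewrite cardE; apply/eqP/perm_size/uniq_perm => //.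
  exact: enum_uniq.
by move=> x; rewrite all_l mem_enum.
Qed.

(** Sorting the vertices by the number of vertices reachable from them gives a
linear extension; the rank is the position in it. *)
Lemma acyclic_ranking e : acyclic e -> exists rk, ranking e rk.
Proof.
move=> acyc; pose key x := #|[set y | connect e x y]|.
have key_e x y : e x y -> key y < key x.
  move=> exy; apply: proper_card; apply/properP; split.
    by apply/subsetP => z; rewrite !inE; apply: connect_trans (connect1 exy).
  exists x; rewrite !inE ?connect0 //; apply/negP => /connectP[p pP def_x].
  have /acyc// : cycle e (y :: p).
  by rewrite /= rcons_path pP -def_x.
have := sort_linear_extension key_e; set l := sort _ _.
case/andP=> tot_l /forallP le_l.
have /andP[_ /forallP all_l] := tot_l.
exists (index^~ l); split=> [x y|x|x y exy].
- by move/index_inj; apply.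
- by rewrite -(eqP (total_order_seq_size tot_l)) index_mem.
- by have /forallP/(_ y) := le_l x; rewrite exy.
Qed.

Lemma exists_linear_extensions e rk : ranking e rk ->
  exists l l', linear_extension e l /\ reverse_linear_extension e l'.
Proof.
move=> rkP; exists (sort (fun a b => rk a <= rk b) (enum T)).
have rkP' := ranking_op rkP.
have := sort_linear_extension (ranking_edge rkP').
set l' := sort _ _ => /andP[tot_l' /forallP le_l']; exists l'; split.
  exact: sort_linear_extension (ranking_edge rkP).
rewrite /reverse_linear_extension tot_l' /=.
apply/forallP => x; apply/forallP => y.
by have /forallP := le_l' y; apply.
Qed.

Lemma ranking_onto e rk i : ranking e rk -> i < #|T| -> exists x, rk x = i.
Proof.
case=> rk_inj rk_b _ lt_i; pose f x := Ordinal (rk_b x).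
have f_inj : injective f by move=> x y /(congr1 val) /rk_inj.
have [|h _ fK] := inj_card_bij f_inj; first by rewrite card_ord.
by exists (h (Ordinal lt_i)); apply: (congr1 val (fK (Ordinal lt_i))).
Qed.

(** * Sequences of flips *)

(** The order of the independence poset, on all pairs rather than on the
subtype of tops, so that it can be dualised. *)
Inductive reach e P : {set T} * {set T} -> Prop :=
| reach_refl : reach e P P
| reach_step g Q R : reach e P Q -> step e g Q R -> reach e P R.

Lemma reach_trans e P Q R : reach e P Q -> reach e Q R -> reach e P R.
Proof. by move=> PQ; elim=> // g Q' R' _ PQ' s; apply: reach_step s. Qed.

Lemma reach1 e g P Q : step e g P Q -> reach e P Q.
Proof. exact: reach_step (reach_refl e P). Qed.

Lemma reach_op e P Q : reach e P Q -> reach (op e) (swap Q) (swap P).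
Proof.
elim=> [|g Q' R _ IH s]; first exact: reach_refl.
by apply: reach_trans IH; apply/reach1/step_op/s.
Qed.

Lemma reach_head e P Q : reach e P Q ->
  P = Q \/ exists g P', step e g P P' /\ reach e P' Q.
Proof.
elim=> [|g Q' R _ IH s]; [by left | right].
case: IH => [->|[h [P' [s' P'Q']]]]; first by exists g, R; split=> //; apply: reach_refl.
by exists h, P'; split=> //; apply: reach_step s.
Qed.

(** Every independent set is the D of a saturated pair: fill U greedily. *)
Lemma exists_saturated e rk D : ranking e rk ->
  (forall x y, x \in D -> y \in D -> ~~ e x y) ->
  exists P, saturated e P /\ P.1 = D.
Proof.
move=> rkP indD; have [l [_ [lext _]]] := exists_linear_extensions rkP.
have irr x : ~~ e x x by apply/negP => /(ranking_edge rkP); rewrite ltnn.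
have [_] := foldl_extend_U D set0 irr (linear_extension_pairwise lext).
set U := foldl _ _ _ => new cov; exists (D, U); split=> //.
have {}new x : x \in U -> [/\ x \notin D,
    forall y, y \in D -> ~~ e y x & forall y, y \in U -> ~~ e x y].
  by move=> xU; have [|//] := new x xU; rewrite inE.
split=> //= [x xD /new[]|x y /new[_ _ + yU]|x y xD /new[_ + _]|k].
- by rewrite xD.
- exact.
- exact.
case/andP: lext => /andP[_ /forallP/(_ k)/cov[kD|kU|?|?] _].
- exact: Or41.
- exact: Or42.
- exact: Or43.
- exact: Or44.
Qed.

Lemma step_eqD_ge e rk g P Q x : ranking e rk -> step e g P Q -> rk g < rk x ->
  (x \in P.1) = (x \in Q.1).
Proof.
move=> rkP s lt_gx; apply: step_eqD s _ _; apply/negP.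
case/(ranking_connect rkP) => [eq_gx|lt_xg]; first by rewrite eq_gx ltnn in lt_gx.
by have := ltn_trans lt_gx lt_xg; rewrite ltnn.
Qed.

Lemma step_eqU_lt e rk g P Q x : ranking e rk -> step e g P Q -> rk x < rk g ->
  (x \in P.2) = (x \in Q.2).
Proof.
move=> rkP s lt_xg; apply: step_eqU s _ _; apply/negP.
case/(ranking_connect rkP) => [eq_gx|lt_gx]; first by rewrite eq_gx ltnn in lt_xg.
by have := ltn_trans lt_gx lt_xg; rewrite ltnn.
Qed.

Lemma step_notinU e g P Q : step e g P Q -> g \notin Q.2.
Proof. by case=> _ satQ _ gD _ _; apply/negP; apply: sat_disj satQ _ gD. Qed.

Lemma step_notinD e g P Q : step e g P Q -> g \notin P.1.
Proof. by case=> satP _ gU _ _ _; apply/negP => /(sat_disj satP). Qed.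

Lemma eq_of_rank e rk i P Q : ranking e rk -> saturated e P -> saturated e Q ->
  (forall x, rk x < i -> (x \in P.2) = (x \in Q.2)) ->
  (forall x, i <= rk x -> (x \in P.1) = (x \in Q.1)) -> P = Q.
Proof.
move=> rkP satP satQ eqU eqD; apply: (eq_of_ideal (I := fun x => rk x < i) rkP) => //.
  by move=> x y /(ranking_edge rkP); apply: ltn_trans.
by move=> x; rewrite -leqNgt; apply: eqD.
Qed.

(** Flip down successively at the vertices of rank i0 - 1, ..., i that are
found in D.  A down-flip at g changes D only below g and U only above g; so it
removes g, does not disturb the ranks treated before, and leaves U as it was
below rank i. *)
Lemma descend e rk P (A : {set T}) i0 i : ranking e rk -> saturated e P ->
  (forall x, i0 <= rk x -> (x \in P.1) = (x \in A)) ->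
  (forall x, x \in A -> i0 <= rk x) -> i <= i0 ->
  exists Q, [/\ saturated e Q, reach e Q P,
    forall x, rk x < i -> (x \in Q.2) = (x \in P.2) &
    forall x, i <= rk x -> (x \in Q.1) = (x \in A)].
Proof.
move=> rkP satP PA A_ge le_i; rewrite -(subKn le_i).
move: (leq_subr i i0); elim: (i0 - i) => [_|n IHn lt_n].
  by rewrite subn0; exists P; split=> //; apply: reach_refl.
have [Q [satQ QP QU QD]] := IHn (ltnW lt_n).
set i' := i0 - n.+1; have def_i' : i0 - n = i'.+1 by rewrite /i' subnSK.
rewrite {}def_i' in QU QD.
have [[x /eqP rk_x xD]|no_x] := altP (@exists_inP _ (fun x => rk x == i') (fun x => x \in Q.1)); last first.
  exists Q; split=> // x; first by move/ltnW/QU.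
  rewrite leq_eqVlt => /predU1P[rk_x|/QD//].
  have -> : x \in A = false.
    by apply/negP => /A_ge; rewrite -rk_x leqNgt /i' ltn_subrL (leq_trans _ lt_n).
  by apply: contraNF no_x => xD; apply/exists_inP; exists x; rewrite ?rk_x.
have [l [l' [lext lext']]] := exists_linear_extensions rkP.
have s := flip_step_down rkP satQ lext lext' xD.
exists (flip e l l' x Q); split; first exact: step_src s.
- exact: reach_trans (reach1 s) QP.
- by move=> y lt_y; rewrite (step_eqU_lt rkP s) ?rk_x // QU // ltnW.
move=> y; rewrite leq_eqVlt => /predU1P[rk_y|lt_y]; last first.
  by rewrite (step_eqD_ge rkP s) ?rk_x // QD.
have -> : y = x by apply: (ranking_inj rkP); rewrite rk_x.
rewrite (negPf (step_notinD s)); apply/esym/negP => /A_ge.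
by rewrite rk_x leqNgt /i' ltn_subrL (leq_trans _ lt_n).
Qed.

(** Descend through the ranks above k.  This empties D there and keeps U up to
rank k, so k, if it was lost on the way, is forced back into D.  Then descend
through the ranks below k: only k is left. *)
Lemma reach_from_D e rk k P J : ranking e rk -> saturated e P -> k \in P.1 ->
  saturated e J -> J.1 = [set k] -> reach e J P.
Proof.
move=> rkP satP kD satJ J1.
have [|||Q [satQ QP QU QD]] := @descend e rk P set0 #|T| (rk k).+1 rkP satP.
- by move=> x; rewrite leqNgt (ranking_bound rkP).
- by move=> x; rewrite inE.
- exact: ranking_bound rkP k.
have kQ : k \in Q.1.
  have kNU x : connect e k x -> x \in Q.2 -> x \in P.2.
    by case/(ranking_connect rkP) => [<-|lt_xk]; rewrite QU // ltnS // ltnW.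
  case: (sat_cover satQ k) => [//|/(kNU _ (connect0 _ _))/(sat_disj satP kD)//|[u uU eku]|[y yD eyk]].
    have /negP[] := sat_DU satP kD (kNU _ (connect1 eku) uU); exact: eku.
  by have := yD; rewrite QD ?inE // (ranking_edge rkP eyk).
have [|||R [satR RQ _ RD]] := @descend e rk Q [set k] (rk k) 0 rkP satQ.
- move=> x; rewrite leq_eqVlt inE => /predU1P[/(ranking_inj rkP)<-|lt_kx].
    by rewrite eqxx.
  by rewrite QD // inE; apply/esym; apply: contraTF lt_kx => /eqP->; rewrite ltnn.
- by move=> x /set1P->.
- by [].
suff -> : J = R by apply: reach_trans RQ QP.
apply: (eq_of_rank (i := 0) rkP) => // x _; by rewrite J1 RD.
Qed.

Lemma reach_to_U e rk k P M : ranking e rk -> saturated e P -> k \in P.2 ->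
  saturated e M -> M.2 = [set k] -> reach e P M.
Proof.
move=> rkP satP kU satM M2; rewrite [P]surjective_pairing [M]surjective_pairing.
apply: (@reach_op (op e) (swap M) (swap P)).
exact: (reach_from_D (k := k) (ranking_op rkP) (saturated_op satP) _ (saturated_op satM)).
Qed.

(** The pairs giving the chain x_0 < ... < x_n of left modular elements. *)
Definition split_at rk i P : Prop :=
  (forall x, rk x < i -> x \notin P.2) /\ (forall x, i <= rk x -> x \notin P.1).

(** The pairs with no element of U of rank < i thus form the principal filter
of the split pair. *)
Lemma reach_from_split e rk i P X : ranking e rk -> saturated e P ->
  (forall x, rk x < i -> x \notin P.2) ->
  saturated e X -> split_at rk i X -> reach e X P.
Proof.
move=> rkP satP NU satX [XU XD].
have [le_i|lt_i] := leqP i #|T|; last first.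
  suff -> : X = P by apply: reach_refl.
  apply: (eq_of_rank (i := i) rkP) => // x => [lt_x|le_x].
    by rewrite (negPf (NU _ _)) // (negPf (XU _ _)).
  by have := ltn_trans lt_i (leq_ltn_trans le_x (ranking_bound rkP x)); rewrite ltnn.
have [|||Q [satQ QP QU QD]] := @descend e rk P set0 #|T| i rkP satP => //.
- by move=> x; rewrite leqNgt (ranking_bound rkP).
- by move=> x; rewrite inE.
suff -> : X = Q by [].
apply: (eq_of_rank (i := i) rkP) => // x => [lt_x|le_x].
  by rewrite QU // (negPf (NU _ _)) // (negPf (XU _ _)).
by rewrite QD // inE (negPf (XD _ _)).
Qed.

(** The vertex g of rank i is not blocked by the split pair at i, hence lies in
its U, and flipping there gives the split pair at i + 1. *)
Lemma exists_split e rk i : ranking e rk -> i <= #|T| ->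
  exists X, saturated e X /\ split_at rk i X.
Proof.
move=> rkP; elim: i => [_|i IHi lt_i].
  have [|X [satX X1]] := @exists_saturated e rk set0 rkP.
    by move=> x y; rewrite inE.
  by exists X; split=> //; split=> // x _; rewrite X1 inE.
have [X [satX [XU XD]]] := IHi (ltnW lt_i).
have [g rk_g] := ranking_onto rkP lt_i.
have gU : g \in X.2.
  case: (sat_cover satX g) => [gD|//|[u uU egu]|[y yD eyg]].
  - by have := XD g; rewrite rk_g leqnn gD => /(_ isT).
  - by have := XU u; rewrite uU -rk_g (ranking_edge rkP egu) => /(_ isT).
  - by have := XD y; rewrite yD -rk_g (ltnW (ranking_edge rkP eyg)) => /(_ isT).
have [l [l' [lext lext']]] := exists_linear_extensions rkP.
have s := flip_step_up rkP satX lext lext' gU.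
exists (flip e l l' g X); split; first exact: step_tgt s.
split=> x; last by move=> lt_ix; rewrite -(step_eqD_ge rkP s) ?rk_g // XD // ltnW.
rewrite ltnS leq_eqVlt => /predU1P[rk_x|lt_xi].
  have -> : x = g by apply: (ranking_inj rkP); rewrite rk_g.
  exact: step_notinU s.
by rewrite -(step_eqU_lt rkP s) ?rk_g // XU.
Qed.

(** [agree_D] and [lt_D] are equality and strict order for the lexicographic
comparison of the parts of D of rank at least i, the highest ranks being the
most significant. *)
Definition agree_D rk i P Q := forall x, i <= rk x -> (x \in P.1) = (x \in Q.1).
Definition lt_D rk i P Q := exists g, [/\ i <= rk g, g \notin P.1, g \in Q.1 &
  forall x, rk g < rk x -> (x \in P.1) = (x \in Q.1)].

Lemma lt_D_trans e rk i P Q R : ranking e rk ->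
  lt_D rk i P Q -> lt_D rk i Q R -> lt_D rk i P R.
Proof.
move=> rkP [g [le_g gP gQ eqPQ]] [h [le_h hQ hR eqQR]].
case: (ltngtP (rk g) (rk h)) => [lt_gh|lt_hg|/(ranking_inj rkP) eq_gh].
- exists h; split=> //; first by rewrite eqPQ.
  by move=> x lt_hx; rewrite eqPQ ?eqQR // (ltn_trans lt_gh).
- exists g; split=> //; first by rewrite -eqQR.
  by move=> x lt_gx; rewrite eqPQ ?eqQR // (ltn_trans lt_hg).
- by rewrite -eq_gh gQ in hQ.
Qed.

(** A flip at g inserts g in D and leaves the ranks above g unchanged. *)
Lemma reach_lex e rk i P Q : ranking e rk -> reach e P Q ->
  agree_D rk i P Q \/ lt_D rk i P Q.
Proof.
move=> rkP; elim=> [|g {}Q R _ IH s]; first by left.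
have [lt_gi|le_ig] := ltnP (rk g) i.
  have QR x : i <= rk x -> (x \in Q.1) = (x \in R.1).
    by move=> le_ix; apply: (step_eqD_ge rkP s); apply: leq_trans le_ix.
  case: IH => [PQ|[h [le_h hP hQ PQ]]]; [left|right].
    by move=> x le_x; rewrite PQ // QR.
  exists h; split; rewrite -?QR // => x lt_hx.
  by rewrite PQ // QR // (leq_trans le_h (ltnW lt_hx)).
have QR : lt_D rk i Q R.
  exists g; split=> //; [exact: step_notinD s|exact: step_D s|].
  by move=> x; apply: step_eqD_ge rkP s.
right; case: IH => [PQ|]; last by move/lt_D_trans; apply; [exact: rkP|].
case: QR => h [le_h hQ hR QR]; exists h; split; rewrite ?PQ //.
by move=> x lt_hx; rewrite PQ ?QR // (leq_trans le_h (ltnW lt_hx)).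
Qed.

Lemma reach_squeeze e rk i P Q R : ranking e rk -> reach e P Q -> reach e Q R ->
  agree_D rk i P R -> agree_D rk i P Q.
Proof.
move=> rkP /(reach_lex i rkP)[//|PQ] /(reach_lex i rkP) QR PR.
have [h [le_h hP hR _]] : lt_D rk i P R.
  case: QR => [QR|]; last exact: lt_D_trans rkP PQ.
  case: PQ => h [le_h hP hQ PQ]; exists h; split; rewrite -?QR //.
  by move=> x lt_hx; rewrite PQ // QR // (leq_trans le_h (ltnW lt_hx)).
by rewrite PR ?hR in hP.
Qed.

(** As long as U has no element of rank < rk k, the membership of k in U can
only be changed by a flip at k itself. *)
Lemma reach_exit e rk k P Q : ranking e rk -> reach e P Q ->
  k \in P.2 -> k \notin Q.2 -> (forall x, rk x < rk k -> x \notin P.2) ->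
  exists Y Y', [/\ reach e P Y, step e k Y Y', reach e Y' Q &
    forall x, rk x < rk k -> x \notin Y.2].
Proof.
move=> rkP PQ kP kQ P_lt.
suff: (k \in Q.2 /\ forall x, rk x < rk k -> x \notin Q.2) \/
  exists Y Y', [/\ reach e P Y, step e k Y Y', reach e Y' Q &
    forall x, rk x < rk k -> x \notin Y.2].
  by case=> // -[kQ' _]; rewrite kQ' in kQ.
elim: PQ {kQ} => [|g {}Q R PQ IH s]; first by left.
case: IH => [[kQ Q_lt]|[Y [Y' [PY sY Y'Q Y_lt]]]]; last first.
  by right; exists Y, Y'; split=> //; apply: reach_step s.
have gU := step_U s.
case: (ltngtP (rk g) (rk k)) => [lt_gk|lt_kg|/(ranking_inj rkP) eq_gk].
- by have := Q_lt g lt_gk; rewrite gU.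
- left; split=> [|x lt_xk]; rewrite -(step_eqU_lt rkP s) //; first exact: Q_lt.
  exact: ltn_trans lt_kg.
- by rewrite eq_gk in s; right; exists Q, R; split=> //; apply: reach_refl.
Qed.

(** The path from P to V flips k at some pair Y.  On ranks above k, D grows
lexicographically along P, Y, Q and is the same at both ends, hence the same
at Y.  As U is {k} up to rank k at both P and Y, this gives Y = P. *)
Lemma step_least e rk k P Q V : ranking e rk -> step e k P Q ->
  (forall x, rk x < rk k -> x \notin P.2) ->
  reach e P V -> reach e V Q -> k \notin V.2 -> reach e Q V.
Proof.
move=> rkP s P_lt PV VQ kV.
have [Y [Y' [PY sY Y'V Y_lt]]] := reach_exit rkP PV (step_U s) kV P_lt.
suff eq_YP : P = Y by rewrite eq_YP in s; rewrite (step_uniq rkP s sY).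
have YQ : reach e Y Q by apply: reach_trans (reach1 sY) (reach_trans Y'V VQ).
apply: (eq_of_rank (i := (rk k).+1) rkP) => [||x|].
- exact: step_src s.
- exact: step_src sY.
- rewrite ltnS leq_eqVlt => /predU1P[/(ranking_inj rkP)->|lt_xk].
    by rewrite (step_U s) (step_U sY).
  by rewrite (negPf (P_lt _ lt_xk)) (negPf (Y_lt _ lt_xk)).
by apply: (reach_squeeze rkP PY YQ) => x; apply: step_eqD_ge rkP s.
Qed.

(** * The independence poset as a lattice *)
Lemma reach_emptyU e rk i P Q : ranking e rk -> reach e P Q ->
  (forall x, rk x < i -> x \notin P.2) -> forall x, rk x < i -> x \notin Q.2.
Proof.
move=> rkP; elim=> // g {}Q R _ IH s /IH Q_lt x lt_xi.
have [lt_gi|le_ig] := ltnP (rk g) i; first by have := Q_lt g lt_gi; rewrite (step_U s).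
by rewrite -(step_eqU_lt rkP s) ?Q_lt // (leq_trans lt_xi).
Qed.

Lemma emptyU_succ e rk k P : ranking e rk ->
  (forall x, rk x < rk k -> x \notin P.2) -> k \notin P.2 ->
  forall x, rk x < (rk k).+1 -> x \notin P.2.
Proof.
move=> rkP P_lt kP x; rewrite ltnS leq_eqVlt => /predU1P[/(ranking_inj rkP)->//|].
exact: P_lt.
Qed.

Lemma exists_saturated_U e rk U : ranking e rk ->
  (forall x y, x \in U -> y \in U -> ~~ e x y) ->
  exists P, saturated e P /\ P.2 = U.
Proof.
move=> rkP indU; have [|P [satP P1]] := @exists_saturated (op e) _ U (ranking_op rkP).
  by move=> x y xU yU; apply: indU.
by exists (swap P); split=> //; apply: saturated_op satP.
Qed.

(** L is a lattice with underlying set the saturated pairs, through the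
bijection [pr], and with the order given by flips. *)
Section Lattice.
Variables (e : rel T) (rk : T -> nat) (d : Order.disp_t) (L : finLatticeType d).
Variable pr : L -> {set T} * {set T}.
Hypothesis rkP : ranking e rk.
Hypothesis pr_sat : forall y, saturated e (pr y).
Hypothesis pr_onto : forall P, saturated e P -> exists y, pr y = P.
Hypothesis pr_le : forall y z, (y <= z)%O <-> reach e (pr y) (pr z).

(** By induction, y = j \/ x_i has the stated property.  Then j \/ x_(i+1) is
y \/ x_(i+1), which is y or the flip of y at the vertex of rank i; in both
cases D is unchanged from rank rk k on. *)
Lemma join_with_split j k i : (pr j).1 = [set k] -> i <= rk k ->
  exists x, split_at rk i (pr x) /\
    forall a, rk k <= rk a -> (a \in (pr (j `|` x)%O).1) = (a == k).
Proof.
move=> j1; elim: i => [_|i IHi lt_ik].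
  have [X [satX splitX]] := exists_split rkP (leq0n _).
  have [x def_X] := pr_onto satX; exists x; rewrite def_X; split=> // a _.
  suff /join_l-> : (x <= j)%O by rewrite j1 inE.
  by apply/pr_le; rewrite def_X; apply: (reach_from_split (i := 0) rkP).
have [x [splitx eqD]] := IHi (ltnW lt_ik).
have lt_iT : i < #|T| := ltn_trans lt_ik (ranking_bound rkP k).
have [g rk_g] := ranking_onto rkP lt_iT.
have [X' [satX' splitX']] := exists_split rkP lt_iT.
have [x' def_X'] := pr_onto satX'.
have x'_le z : (forall a, rk a < i.+1 -> a \notin (pr z).2) -> (x' <= z)%O.
  by move=> z_lt; apply/pr_le; rewrite def_X'; apply: reach_from_split rkP _ z_lt _ _.
set y := (j `|` x)%O in eqD.
have le_xx' : (x <= x')%O.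
  apply/pr_le; apply: reach_from_split rkP _ _ _ splitx => // a lt_ai.
  by rewrite def_X'; apply: (splitX'.1); apply: ltnW.
have y_lt a : rk a < i -> a \notin (pr y).2.
  have /pr_le x_y : (x <= y)%O by apply: leUr.
  exact: (reach_emptyU rkP x_y splitx.1).
exists x'; rewrite def_X'; split=> // a le_ka.
have -> : (j `|` x')%O = (y `|` x')%O by rewrite /y -joinA (join_r le_xx').
have [gU|gU] := boolP (g \in (pr y).2); last first.
  suff /join_l-> : (x' <= y)%O by apply: eqD.
  by apply: x'_le; rewrite -rk_g; apply: (emptyU_succ rkP) => //; rewrite rk_g.
have [l [l' [lext lext']]] := exists_linear_extensions rkP.
have := flip_step_up rkP (pr_sat y) lext lext' gU.
set W := flip _ _ _ _ _ => s; have [w def_W] := pr_onto (step_tgt s).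
rewrite -{}def_W in s.
have w_lt b : rk b < i.+1 -> b \notin (pr w).2.
  rewrite -rk_g; apply: (emptyU_succ rkP); last exact: step_notinU s.
  by rewrite rk_g => c lt_c; rewrite -(step_eqU_lt rkP s) ?rk_g // y_lt.
have le_vw : ((y `|` x') <= w)%O.
  by rewrite leUx x'_le // andbT; apply/pr_le/reach1/s.
(* The join is squeezed between y and its flip w, and has lost g from U. *)
have -> : (y `|` x')%O = w.
  apply/eqP; rewrite eq_le le_vw /=; apply/pr_le.
  apply: (step_least rkP s); first by rewrite rk_g.
  - by apply/pr_le; apply: leUl.
  - exact/pr_le.
  have /pr_le x'_v : (x' <= y `|` x')%O by apply: leUr.
  have x'_lt : forall b, rk b < i.+1 -> b \notin (pr x').2 by rewrite def_X'; apply: (splitX'.1).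
  by apply: (reach_emptyU rkP x'_v x'_lt); rewrite rk_g.
rewrite -(step_eqD_ge rkP s) ?eqD // rk_g.
exact: leq_trans lt_ik le_ka.
Qed.

(** Suppose j <= m, and let y = j \/ x_(rk k).  Then k is in D_y, so U_y has no
element of rank up to rk k; everything above y inherits this, in particular m,
whose U contains k. *)
Lemma label_nle j m k : (pr j).1 = [set k] -> (pr m).2 = [set k] -> ~~ (j <= m)%O.
Proof.
move=> j1 m2; apply/negP => le_jm.
have [x [splitx eqD]] := join_with_split j1 (leqnn _).
set y := (j `|` x)%O in eqD.
have le_xm : (x <= m)%O.
  apply/pr_le; apply: reach_from_split rkP _ _ _ splitx => // a.
  by rewrite m2 inE; apply: contraTN => /eqP->; rewrite ltnn.
have /pr_le y_m : (y <= m)%O by rewrite leUx le_jm.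
have /pr_le x_y : (x <= y)%O by apply: leUr.
have kD : k \in (pr y).1 by rewrite eqD.
have kU : k \notin (pr y).2 by apply/negP => /(sat_disj (pr_sat y) kD).
have y_lt := emptyU_succ rkP (reach_emptyU rkP x_y splitx.1) kU.
by have := reach_emptyU rkP y_m y_lt (ltnSn _); rewrite m2 set11.
Qed.

Theorem trim_of_reach : trim L.
Proof.
have irr k x y : x \in [set k] -> y \in [set k] -> ~~ e x y.
  by move=> /set1P-> /set1P->; apply/negP => /(ranking_edge rkP); rewrite ltnn.
have [j j1] : exists j : T -> L, forall k, (pr (j k)).1 = [set k].
  apply: (@fin_all_exists T (fun=> L) (fun k j => (pr j).1 = [set k])) => k.
  have [P [satP P1]] := exists_saturated rkP (@irr k).
  by have [y def_P] := pr_onto satP; exists y; rewrite def_P.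
have [m m2] : exists m : T -> L, forall k, (pr (m k)).2 = [set k].
  apply: (@fin_all_exists T (fun=> L) (fun k m => (pr m).2 = [set k])) => k.
  have [P [satP P2]] := exists_saturated_U rkP (@irr k).
  by have [y def_P] := pr_onto satP; exists y; rewrite def_P.
have [x splitx] : exists x : 'I_#|T|.+1 -> L, forall i : 'I_#|T|.+1, split_at rk i (pr (x i)).
  apply: (@fin_all_exists _ (fun=> L) (fun (i : 'I_#|T|.+1) x => split_at rk i (pr x))) => i.
  have [X [satX splitX]] : exists X, saturated e X /\ split_at rk i X.
    by apply: exists_split rkP _; rewrite -ltnS.
  by have [y def_X] := pr_onto satX; exists y; rewrite def_X.
have pr_inj y z : pr y = pr z -> y = z.
  by move=> eq_pr; apply/le_anti/andP; split; apply/pr_le; rewrite eq_pr; apply: reach_refl.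
have j_le k z : k \in (pr z).1 -> (j k <= z)%O.
  by move=> kD; apply/pr_le; apply: (reach_from_D rkP _ kD).
have le_m k z : k \in (pr z).2 -> (z <= m k)%O.
  by move=> kU; apply/pr_le; apply: (reach_to_U rkP _ kU).
have x_le (i : 'I_#|T|.+1) z : (forall a, rk a < i -> a \notin (pr z).2) -> (x i <= z)%O.
  by move=> z_lt; apply/pr_le; apply: reach_from_split rkP _ z_lt _ _.
have x_mono : {homo x : i i' / i <= i' >-> (i <= i')%O}.
  move=> i i' le_ii'; apply: x_le => a lt_ai.
  by apply: (splitx i').1; apply: leq_trans le_ii'.
apply: (@trim_of_labels _ L T rk j m x) => // [i|k|y z lt_yz|y z lt_yz|k i].
- exact: ranking_onto rkP.
- exact: label_nle (j1 k) (m2 k).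
- have /pr_le/reach_head[/pr_inj eq_yz|[g [P [s Pz]]]] := ltW lt_yz.
    by rewrite eq_yz ltxx in lt_yz.
  have [y' def_P] := pr_onto (step_tgt s); rewrite -def_P in s Pz.
  exists g, y'; split; [exact/pr_le/reach1/s|exact/pr_le| |].
    by apply: j_le; apply: step_D s.
  by apply: le_m; apply: step_U s.
- have /pr_le yz := ltW lt_yz; move: lt_yz.
  case def_z: _ / yz => [|g Q R yQ s].
    by rewrite (pr_inj _ _ def_z) ltxx.
  move=> lt_yz; have [z' def_Q] := pr_onto (step_src s); rewrite -def_Q -def_z in s yQ.
  exists g, z'; split; [exact/pr_le|exact/pr_le/reach1/s| |].
    by apply: j_le; apply: step_D s.
  by apply: le_m; apply: step_U s.
(* For rk k < i it suffices to see that k is in D for the split pair at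
   rk k + 1, where nothing blocks it. *)
case: ltnP => [lt_ki|le_ik]; last first.
  apply: x_le => a; rewrite m2 inE; apply: contraTN => /eqP->.
  by rewrite -leqNgt.
have lt_kT : (rk k).+1 < #|T|.+1 by rewrite ltnS (ranking_bound rkP).
apply: (@Order.POrderTheory.le_trans _ _ (x (Ordinal lt_kT))); last exact: x_mono.
apply: j_le; have [xU xD] := splitx (Ordinal lt_kT).
case: (sat_cover (pr_sat (x (Ordinal lt_kT))) k) => [//|kU|[u uU eku]|[y yD eyk]].
- by have := xU k; rewrite kU ltnSn => /(_ isT).
- by have := xU u; rewrite uU ltnS (ltnW (ranking_edge rkP eku)) => /(_ isT).
- by have := xD y; rewrite yD (ranking_edge rkP eyk) => /(_ isT).
Qed.
End Lattice.
End Pairs.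

Lemma flip_mem_D (T : finType) (e : rel T) l l' g (P : {set T} * {set T}) :
  g \in P.2 -> g \in (flip e l l' g P).1.
Proof.
case: P => D U /= gU; rewrite inE gU orbT /=.
move: (if _ then _ else _) => U1; move: (g |: _) (setU11 g [set k in D | ~~ geG e g k]).
elim: (filter _ _) => //= k s IHs B gB; apply: IHs.
by rewrite /extend_D; case: ifP => // _; rewrite setU1r.
Qed.

(** * From tops to saturated pairs *)

Section Tops.
Variables (T : finType) (e : rel T) (rk : T -> nat).
Hypothesis rkP : ranking e rk.

Lemma flip_up_step (P Q : top e) : saturated e (val P) -> flip_up P Q ->
  exists g, step e g (val P) (val Q).
Proof.
move=> satP /exists_inP[g gU /existsP[l /existsP[l' /and3P[lext lext' /eqP->]]]].
by exists g; apply: flip_step_up rkP _ _ _ gU.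
Qed.

Lemma step_flip_up (P Q : top e) g : step e g (val P) (val Q) -> flip_up P Q.
Proof.
move=> s; have [l [l' [lext lext']]] := exists_linear_extensions rkP.
have sz_l : size l == #|T| by apply: total_order_seq_size; case/andP: lext.
have sz_l' : size l' == #|T| by apply: total_order_seq_size; case/andP: lext'.
apply/exists_inP; exists g; first exact: step_U s.
apply/existsP; exists (Tuple sz_l); apply/existsP; exists (Tuple sz_l').
rewrite /= lext lext'; apply/eqP; apply: (step_uniq rkP s).
exact: flip_step_up rkP (step_src s) lext lext' (step_U s).
Qed.

Lemma top_le_reach (P Q : top e) : saturated e (val P) -> top_le P Q ->
  saturated e (val Q) /\ reach e (val P) (val Q).
Proof.
move=> satP /connectP[p + ->]; elim: p P satP => [|R p IHp] P satP /=.
  by split=> //; apply: reach_refl.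
case/andP=> /(flip_up_step satP)[g s] /(IHp _ (step_tgt s))[satQ RQ].
by split=> //; apply: reach_trans (reach1 s) RQ.
Qed.

Lemma reach_top_le (P Q : top e) : reach e (val P) (val Q) -> top_le P Q.
Proof.
move: {2}(val Q) (erefl (val Q)) => Q0 def_Q PQ; rewrite def_Q in PQ.
elim: PQ Q def_Q => [|g R S _ IH s] Q def_Q.
  by rewrite (val_inj def_Q); apply: connect0.
have topR := saturated_is_top rkP (step_src s).
apply: connect_trans (IH (Sub R topR) _) (connect1 _); first exact: SubK.
by apply: (@step_flip_up _ _ g); rewrite SubK def_Q.
Qed.

(** Let X0 be the top with D empty.  An up-flip at g puts g in D, even from a
top that is not saturated, so nothing is below X0.  The meet of X0 with any
top is therefore X0, and every top is reached by flips from X0. *)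
Lemma all_saturated (d : Order.disp_t) (L : finLatticeType d) (f : top e -> L) :
  bijective f -> (forall P Q, (f P <= f Q)%O = top_le P Q) ->
  forall P : top e, saturated e (val P).
Proof.
case=> h fK hK f_iso P.
have [|X [satX X1]] := @exists_saturated _ e rk set0 rkP; first by move=> x y; rewrite inE.
pose X0 : top e := Sub X (saturated_is_top rkP satX).
have X0_min Q : top_le Q X0 -> Q = X0.
  case/connectP=> p pP def_X0; case: p / (lastP p) pP def_X0 => [|p R]; first by [].
  rewrite rcons_path last_rcons => /andP[_ + def_X0]; rewrite -{R}def_X0.
  case/exists_inP=> g gU /existsP[l /existsP[l' /and3P[_ _ /eqP def_X]]].
  by have := flip_mem_D e l l' gU; rewrite -def_X SubK X1 inE.
have le_X0P : top_le X0 P.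
  have def_Q : f (h (f X0 `&` f P)%O) = (f X0 `&` f P)%O by apply: hK.
  have Q_X0 : h (f X0 `&` f P)%O = X0 by apply: X0_min; rewrite -f_iso def_Q leIl.
  by rewrite -f_iso -{1}Q_X0 def_Q leIr.
by have [] := top_le_reach (P := X0) satX le_X0P.
Qed.
End Tops.

Theorem theorem1p6 (T : finType) (e : rel T) (e_acyclic : acyclic e)
    (d : Order.disp_t) (L : finLatticeType d) (f : top e -> L)
    (f_bij : bijective f)
    (f_iso : forall P Q : top e, (f P <= f Q)%O = top_le P Q) :
  trim L.
Proof.
have [rk rkP] := acyclic_ranking e_acyclic.
have sat := all_saturated rkP f_bij f_iso.
case: f_bij => h fK hK.
apply: (@trim_of_reach _ e rk _ L (fun y => val (h y)) rkP) => [y|P satP|y z].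
- exact: sat.
- by exists (f (Sub P (saturated_is_top rkP satP))); rewrite fK SubK.
rewrite -{1}(hK y) -{1}(hK z) f_iso; split; last exact: (reach_top_le rkP).
by case/(top_le_reach rkP (sat _)).
Qed.
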